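(* Assume that for every $a\in A$ the set $\mathcal P_a$ is closed. Suppose that at each state $\omega\in\Omega$ there is a unique sender-optimal action, i.e. a unique $a\in A$ with $v(\omega,a)\ge v(\omega,a')$ for all $a'\in A$. For $a\in A$ and $\omega\in\Omega$ let $$\Upsilon_a=\{\omega\in\Omega: v(\omega,a)\ge v(\omega,a')\ \text{for all } a'\in A\},\qquad t_a^*(\omega)=\mu^*(\omega)\,\mathbf 1\{\omega\in\Upsilon_a\}.$$ Then the sender can fully persuade the receiver if and only if $t_a^*\in\mathrm{Conv}(\mathcal P_a\cup\{\mathbf 0\})$ for every $a\in A$.
   Context: $\Omega$ (states) and $A$ (actions) are finite nonempty sets. $\Delta(\Omega)\subset\mathbb R^{\Omega}$ is the simplex of probability vectors with the Euclidean topology, and $\mu^*\in\Delta(\Omega)$ is a common prior. The receiver's utility is an arbitrary function $\rho:\Delta(\Omega)\times A\to\mathbb R$; the sender's utility is $v:\Omega\times A\to\mathbb R$. For $a\in A$, $\mathcal P_a=\{\mu\in\Delta(\Omega): a\in\arg\max_{a'\in A}\rho(\mu,a')\}$. $\mathrm{Conv}$ denotes convex hull and $\mathbf 0\in\mathbb R^{\Omega}$ the zero vector. A signaling scheme $(S,\pi)$ consists of a (standard Borel) signal space $S$ and a joint distribution $\pi$ of $(\bar\omega,\bar s)$ on $\Omega\times S$ with $\Omega$-marginal $\mu^*$; $\mu_s$ is the conditional distribution of $\bar\omega$ given $\bar s=s$. A (measurable) receiver strategy $a:S\to A$ is optimal if $a(s)\in\arg\max_{a\in A}\rho(\mu_s,a)$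 for all $s$; when there are several, the receiver uses one preferred by the sender. A scheme fully persuades the receiver if, with such an optimal strategy $a(\cdot)$, one has $\bar\omega\in\Upsilon_{a(\bar s)}$ $\pi$-almost surely (for countable $S$: whenever $\pi(\omega,s)>0$ and $a(s)=a$, then $\omega\in\Upsilon_a$). The sender can fully persuade the receiver if there is a signaling scheme that fully persuades the receiver. *)

(* Defs.v *)
From HB Require Import structures.
From mathcomp Require Import all_boot all_order all_algebra.
From mathcomp Require Import all_classical all_reals all_analysis.

Set Implicit Arguments.
Unset Strict Implicit.
Unset Printing Implicit Defensive.

Import Order.TTheory GRing.Theory Num.Theory.
Import numFieldNormedType.Exports.

Local Open Scope classical_set_scope.
Local Open Scope ring_scope.

(* [T] with the sigma-algebra of all its subsets.  A [measurableType] must be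
   pointed; [x0] is that point and has no other role. *)
Definition discrete_space (T : choiceType) (x0 : T) : Type := T.

Section discrete_space_instances.
Variables (T : choiceType) (x0 : T).

HB.instance Definition _ := Choice.on (discrete_space x0).
HB.instance Definition _ := isPointed.Build (discrete_space x0) x0.
HB.instance Definition _ :=
  @isMeasurable.Build default_measure_display (discrete_space x0)
    discrete_measurable discrete_measurable0
    discrete_measurableC discrete_measurableU.

End discrete_space_instances.

(* [S] is isomorphic, as a measurable space, to the Borel space of a complete
   separable metric space.  A Hausdorff pseudometric is a metric. *)
Definition standard_borel (R : realType) (d : measure_display)
    (S : measurableType d) : Prop :=
  exists (T : completePseudoMetricType R) (f : S -> T),
    [/\ hausdorff_space T,
        exists2 D : set T, countable D & dense D,
        bijective f &
        forall B : set S, measurable B <-> <<s [set U : set T | open U] >> (f @` B)].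

Definition conv_hull (R : realType) (V : lmodType R) (X : set V) : set V :=
  smallest (@convex_set R V) X.

Section persuasion.
Context {R : realType} {Omega A : finType}.

Definition simplex : set (Omega -> R) :=
  [set mu | (forall w, 0 <= mu w) /\ \sum_w mu w = 1].

(* [rho] is only ever evaluated at elements of [simplex]. *)
Definition best_response (rho : (Omega -> R) -> A -> R) (a : A) :
    set (Omega -> R) :=
  [set mu | simplex mu /\ forall a', rho mu a' <= rho mu a].

Definition sender_optimal (v : Omega -> A -> R) (a : A) : set Omega :=
  [set w | forall a', v w a' <= v w a].

Definition tstar (mu0 : Omega -> R) (v : Omega -> A -> R) (a : A) :
    Omega -> R :=
  fun w => mu0 w * \1_(sender_optimal v a) w.

Record signaling_scheme (w0 : Omega) (mu0 : Omega -> R) := SignalingScheme {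
  signal_display : measure_display;
  signal : measurableType signal_display;
  joint : probability (discrete_space w0 * signal)%type R;
  signal_standard_borel : standard_borel R signal;
  joint_marginal : forall w : discrete_space w0,
    joint ([set w] `*` [set: signal]) = (mu0 w)%:E
}.

(* [post] is a version of the conditional distribution of the state given the
   signal: P(state = w, signal \in B) = E[post signal w; signal \in B]. *)
Definition is_posterior (w0 : Omega) (mu0 : Omega -> R)
    (sch : signaling_scheme w0 mu0) (post : signal sch -> Omega -> R) : Prop :=
  [/\ forall s, simplex (post s),
      forall w, measurable_fun [set: signal sch] (post ^~ w) &
      forall (w : discrete_space w0) (B : set (signal sch)), measurable B ->
        joint sch ([set w] `*` B) =
        (\int[joint sch]_(p in [set: discrete_space w0] `*` B)
           (post p.2 w)%:E)%E].

(* A measurable receiver strategy that best-responds to every posterior and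
   breaks ties in favour of the sender's expected utility. *)
Definition optimal_strategy (rho : (Omega -> R) -> A -> R)
    (v : Omega -> A -> R) (a0 : A) (d : measure_display) (S : measurableType d)
    (post : S -> Omega -> R) (act : S -> discrete_space a0) : Prop :=
  [/\ measurable_fun [set: S] act,
      forall s, best_response rho (act s) (post s) &
      forall s a', best_response rho a' (post s) ->
        \sum_w post s w * v w a' <= \sum_w post s w * v w (act s)].

Definition fully_persuades (rho : (Omega -> R) -> A -> R)
    (v : Omega -> A -> R) (w0 : Omega) (a0 : A) (mu0 : Omega -> R)
    (sch : signaling_scheme w0 mu0) : Prop :=
  exists (post : signal sch -> Omega -> R)
         (act : signal sch -> discrete_space a0),
    [/\ is_posterior post,
        optimal_strategy rho v post act &
        {ae joint sch, forall p, sender_optimal v (act p.2) p.1}].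

Definition can_fully_persuade (rho : (Omega -> R) -> A -> R)
    (v : Omega -> A -> R) (w0 : Omega) (a0 : A) (mu0 : Omega -> R) : Prop :=
  exists sch : signaling_scheme w0 mu0, fully_persuades rho v a0 sch.

End persuasion.

(* Main.v *)
(* If a scheme fully persuades, uniqueness of the sender-optimal action makes
   t_a the joint mass of the state and the event "the action is a"; normalized,
   it is the mean of the posterior on that event, where the posterior lies in
   P_a.  In finite dimension the mean of a random vector with values in a set X
   is a finite convex combination of points of X, whether or not X is closed.
   This is proved by induction on the number of coordinates: if the mean is not
   such a combination, a nonzero functional weakly separates X from it, so the
   functional is almost surely constant and one coordinate is determined by the
   others.
   Conversely, write each t_a as a combination of points of P_a and 0, and take
   one signal per point of P_a that carries mass, with that point as posterior
   and a as action.  Posteriors for a are supported on states where a is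
   sender-optimal, so the sender-favourable tie-breaking holds. *)

From HB Require Import structures.
Require Import Defs.
From mathcomp Require Import all_boot all_order all_algebra finmap.
From mathcomp Require Import all_classical all_reals all_analysis.
From mathcomp Require Import measurable_realfun ring lra.

Set Implicit Arguments.
Unset Strict Implicit.
Unset Printing Implicit Defensive.

Import Order.TTheory GRing.Theory Num.Theory.
Import numFieldNormedType.Exports.

Local Open Scope classical_set_scope.
Local Open Scope ring_scope.

(** * Convex combinations and weak separation *)

Section convex_mixtures.
Variables (R : realType) (I : finType).

Definition weights (K : finType) (lam : K -> R) : Prop :=
  (forall k, 0 <= lam k) /\ \sum_k lam k = 1.

(** The points stay in [T] and only coordinates in [J] are matched, so an induction can drop
    coordinates from [J] while still sampling from [D]. *)
Definition mixture (T : Type) (D : set T) (J : {set I}) (f : T -> I -> R)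
    (m : I -> R) : Prop :=
  exists (K : finType) (lam : K -> R) (s : K -> T),
    [/\ weights lam, forall k, D (s k) &
        forall j, j \in J -> m j = \sum_k lam k * f (s k) j].

Lemma coord_continuous (V : eqType) (i : V) :
  continuous (fun g : {ptws V -> R} => g i : R).
Proof. exact: (@proj_continuous V (fun=> R) i). Qed.

Lemma sum_continuous (T : topologicalType) (K : finType) (P : pred K)
    (F : K -> T -> R) :
  (forall k, continuous (F k)) -> continuous (fun x => \sum_(k | P k) F k x).
Proof.
by move=> cF; apply: (@continuous_big R K +%R 0 P (@add_continuous R^o)) => k _;
  exact: cF.
Qed.

Lemma mul_continuous (T : topologicalType) (f g : T -> R) :
  continuous f -> continuous g -> continuous (fun x => f x * g x).
Proof. by move=> cf cg x; apply: cvgM; [exact: cf|exact: cg]. Qed.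

(** The weights form a closed subset of the cube $[0,1]^K$, which is compact by Tychonoff. *)
Lemma weights_compact (K : finType) :
  compact ([set lam | weights lam] : set {ptws K -> R}).
Proof.
have cube : compact [set g : {ptws K -> R} | forall k, `[0, 1]%classic (g k)].
  by apply: (@tychonoff K (fun=> R) (fun=> `[0, 1]%classic)) => k;
    exact: segment_compact.
apply: (subclosed_compact _ cube).
  rewrite (_ : mkset _ = (\bigcap_k [set g : {ptws K -> R} | 0 <= g k]) `&`
      [set g : {ptws K -> R} | \sum_k g k = 1]); last first.
    apply/seteqP; split => g [g0 g1]; split => // k;
      [by move=> _; exact: g0|exact: g0].
  apply: closedI.
    apply: closed_bigI => k _.
    by apply: (closed_comp _ (@closed_ge R 0)) => x _; exact: coord_continuous.
  apply: (closed_comp _ (@closed_eq R 1)) => x _.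
  apply: (@sum_continuous {ptws K -> R} K _ (fun k g => g k)) => k.
  exact: coord_continuous.
move=> g [g0 g1] k /=; rewrite in_itv/= g0 -g1 (bigD1 k)//=.
by rewrite lerDl sumr_ge0.
Qed.

(* The nearest point to the origin in the convex hull of the [x k] is the
   separating functional. *)
Lemma gordan (K : finType) (J : {set I}) (x : K -> I -> R) :
  (exists2 lam : K -> R, weights lam &
     forall j, j \in J -> \sum_k lam k * x k j = 0) \/
  exists l : I -> R, forall k, 0 < \sum_(j in J) l j * x k j.
Proof.
have [k0 _|K0] := pickP {: K}; last by right; exists 0 => k; move: (K0 k).
pose p (lam : K -> R) j := \sum_k lam k * x k j.
pose phi (lam : {ptws K -> R}) : R := \sum_(j in J) p lam j * p lam j.
have cphi : continuous phi.
  apply: (@sum_continuous {ptws K -> R} I _ (fun j lam => p lam j * p lam j)).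
  have cp j : continuous (fun lam : {ptws K -> R} => p lam j).
    apply: (@sum_continuous {ptws K -> R} K _ (fun k lam => lam k * x k j)) => k.
    apply: (@mul_continuous {ptws K -> R} (fun lam => lam k) (fun=> x k j)).
      exact: coord_continuous.
    exact: (@cst_continuous {ptws K -> R} R (x k j)).
  by move=> j; apply: (@mul_continuous {ptws K -> R} (p ^~ j) (p ^~ j)).
have e_w (k : K) : weights (fun i : K => (i == k)%:R : R).
  split=> [i|]; first exact: ler0n.
  by rewrite (bigD1 k)//= eqxx big1 ?addr0// => i /negbTE ->.
have [|c] := compact_EVT_min _ (@weights_compact K) (continuous_subspaceT cphi).
  by exists (fun i => (i == k0)%:R); exact: e_w.
rewrite inE => -[c0 c1] cmin.
have [pc0|pc0] := pselect (forall j, j \in J -> p c j = 0); [left|right].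
  by exists c.
exists (p c) => k.
have phi_gt0 : 0 < phi c.
  rewrite lt_neqAle sumr_ge0 ?andbT => [|j _]; last by rewrite -expr2 sqr_ge0.
  rewrite eq_sym; apply: contra_notN pc0 => /eqP phi0 j jJ; apply/eqP.
  move/eqP: phi0; rewrite psumr_eq0 => [|i _]; last by rewrite -expr2 sqr_ge0.
  by move=> /allP/(_ j (mem_index_enum _))/implyP/(_ jJ); rewrite mulf_eq0 orbb.
apply: (lt_le_trans phi_gt0); rewrite -subr_ge0.
pose u := \sum_(j in J) p c j * (x k j - p c j).
pose q := \sum_(j in J) (x k j - p c j) ^+ 2.
have q0 : 0 <= q by apply: sumr_ge0 => j _; exact: sqr_ge0.
have -> : \sum_(j in J) p c j * x k j - phi c = u.
  by rewrite -sumrB; apply: eq_bigr => j _; ring.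
(* Moving a fraction [t] of the way from the minimizer [c] to the vertex [k] changes [phi] by
   exactly this quadratic, so minimality makes it nonnegative. What remains is to deduce
   [0 <= u]. *)
have step t : 0 <= t <= 1 -> 0 <= 2 * t * u + t ^+ 2 * q.
  move=> /andP[t0 t1];
  pose ct : K -> R := fun i => c i + t * ((i == k)%:R - c i).
  have wct : weights ct.
    split=> [i|].
      have -> : ct i = (1 - t) * c i + t * (i == k)%:R by rewrite /ct; ring.
      by rewrite addr_ge0 ?mulr_ge0 ?subr_ge0// ler0n.
    by rewrite big_split/= -mulr_sumr sumrB c1 (e_w k).2 subrr mulr0 addr0.
  have := cmin ct; rewrite inE => /(_ wct); rewrite -subr_ge0.
  congr (0 <= _); rewrite !mulr_sumr -sumrB -big_split/=; apply: eq_bigr => j _.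
  have -> : p ct j = p c j + t * (x k j - p c j).
    rewrite /p /ct; under eq_bigr do rewrite mulrDl -mulrA mulrBl.
    rewrite big_split/= -mulr_sumr sumrB; congr (_ + t * (_ - _)).
    by rewrite (bigD1 k)//= eqxx mul1r big1 ?addr0// => i /negbTE ->;
      rewrite mul0r.
  by ring.
rewrite leNgt; apply/negP => u0.
have qu : 0 < q - u by lra.
(* If [u < 0], the linear term dominates for small [t]. The denominator [q - u] is positive even
   when [q = 0] and keeps [t] in the unit interval. *)
have := step (- u / (q - u)).
have -> : 0 <= - u / (q - u) <= 1.
  by rewrite divr_ge0 ?ler_pdivrMr//=; lra.
move=> /(_ isT).
have -> : 2 * (- u / (q - u)) * u + (- u / (q - u)) ^+ 2 * q =
   (- u / (q - u)) * (u - u ^+ 2 / (q - u)) .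
  by field; rewrite gt_eqF.
rewrite leNgt => /negP; apply.
rewrite pmulr_rlt0; last by rewrite divr_gt0//; lra.
have : 0 <= u ^+ 2 / (q - u) by rewrite divr_ge0 ?sqr_ge0// ltW.
lra.
Qed.

(* Compactness of the unit sphere reduces the claim to finitely many points. *)
Lemma weak_separation (T : choiceType) (D : set T) (J : {set I})
    (f : T -> I -> R) :
  D !=set0 ->
  mixture D J f (fun=> 0) \/
  exists2 l : I -> R, exists2 j, j \in J & l j != 0 &
    forall s, D s -> 0 <= \sum_(j in J) l j * f s j.
Proof.
move=> [s0 Ds0].
have [|no_mix] := pselect (mixture D J f (fun=> 0)); [by left|right].
(* The norm sees only the coordinates in [J]; the cube bounds the others, which gives
   compactness. *)
pose sphere := [set l : {ptws I -> R} | (forall j, `[-1, 1]%classic (l j)) /\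
  \sum_(j in J) l j * l j = 1].
have csphere : compact sphere.
  apply: (@compact_closedI {ptws I -> R}
    [set l | forall j, `[-1, 1]%classic (l j)]
    [set l | \sum_(j in J) l j * l j = 1]).
    by apply: (@tychonoff I (fun=> R) (fun=> `[-1, 1]%classic)) => j;
      exact: segment_compact.
  apply: (closed_comp _ (@closed_eq R 1)) => x _.
  apply: (@sum_continuous {ptws I -> R} I _ (fun j l => l j * l j)) => j.
  by apply: (@mul_continuous {ptws I -> R} (fun l => l j) (fun l => l j));
    exact: coord_continuous.
pose h s (l : {ptws I -> R}) := \sum_(j in J) l j * f s j.
have closed_h s : closed [set l | 0 <= h s l].
  apply: (closed_comp _ (@closed_ge R 0)) => x _.
  apply: (@sum_continuous {ptws I -> R} I _ (fun j l => l j * f s j)) => j.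
  apply: (@mul_continuous {ptws I -> R} (fun l => l j) (fun=> f s j)).
    exact: coord_continuous.
  exact: (@cst_continuous {ptws I -> R} R (f s j)).
have fin_sep : finI D (fun s => sphere `&` [set l | 0 <= h s l]).
  (* Adding [s0] makes the finite family nonempty: strict positivity at [s0] then prevents [l0] from
     vanishing on all of [J], so it can be normalized. *)
  move=> F FD; pose F' := (s0 |` F)%fset.
  have [[lam lam_w lam0]|[l0 l0_gt0]] := gordan J (fun k : F' => f (val k)).
    exfalso; apply: no_mix; exists F', lam, val; split => //.
      move=> k; have := valP k; rewrite !inE => /orP[/eqP->//|/FD].
      by rewrite inE.
    by move=> j jJ; rewrite lam0.
  pose n2 := \sum_(j in J) l0 j ^+ 2.
  have s0F' : s0 \in F' by rewrite !inE eqxx.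
  have n2_gt0 : 0 < n2.
    rewrite lt_neqAle sumr_ge0 ?andbT => [|j _]; last exact: sqr_ge0.
    apply: contraTneq (l0_gt0 [` s0F']%fset) => /esym/eqP.
    rewrite psumr_eq0 => [/allP l00|j _]; last exact: sqr_ge0.
    rewrite big1 ?ltxx// => j jJ.
    have /implyP/(_ jJ) := l00 j (mem_index_enum _).
    by rewrite sqrf_eq0 => /eqP ->; rewrite mul0r.
  pose l j := if j \in J then l0 j / Num.sqrt n2 else 0.
  have sq_l : \sum_(j in J) l j * l j = 1.
    have -> : 1 = n2 / n2 by rewrite divff// gt_eqF.
    rewrite mulr_suml; apply: eq_bigr => j jJ; rewrite /l jJ.
    by rewrite mulrACA -expr2 -invfM -expr2 sqr_sqrtr// ltW.
  have l_sphere : sphere l.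
    split => // j /=; rewrite in_itv/= -ler_norml -(@expr_le1 _ 2)//.
    rewrite real_normK ?num_real// -sq_l.
    have [jJ|/negbTE jJ] := boolP (j \in J); last first.
      rewrite /l jJ expr0n; apply: sumr_ge0 => i _.
      by case: ifP => _; rewrite -expr2 sqr_ge0.
    rewrite (bigD1 j)//= -expr2 lerDl; apply: sumr_ge0 => i _.
    by rewrite -expr2 sqr_ge0.
  exists l => s /= sF; split => //=; rewrite /h.
  have sF' : s \in F' by rewrite !inE sF orbT.
  have := l0_gt0 [` sF']%fset => /= /ltW.
  rewrite (_ : \sum_(j in J) l j * f s j =
    (\sum_(j in J) l0 j * f s j) / Num.sqrt n2) => [?|].
    by rewrite divr_ge0// sqrtr_ge0.
  rewrite mulr_suml; apply: eq_bigr => j jJ.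
  by rewrite /l jJ mulrAC.
(* The finite intersection property yields a cluster point in the sphere; it lies in every
   half-space because these are closed. *)
have FF := finI_filter fin_sep.
have [|l [[_ l1] lF]] := csphere _ FF.
  exists (sphere `&` [set l | 0 <= h s0 l]); first exact: finI_from1.
  by move=> ? [].
exists l.
  apply: contrapT => l0; move: l1; rewrite big1 => [/esym/eqP|j jJ].
    by rewrite oner_eq0.
  apply/eqP; rewrite mulf_eq0 orbb; apply/negP => /negP lj; apply: l0.
  by exists j.
move=> s Ds; apply: (closed_h s) => B /lF; apply.
exists (sphere `&` [set l | 0 <= h s l]); first exact: finI_from1.
by move=> ? [].
Qed.

End convex_mixtures.

(** * The mean of a random vector *)

Section mean_of_measure.
Context d (T : measurableType d) (R : realType) (I : finType).
Variable mu : {measure set T -> \bar R}.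

(* If 0 is not already a mixture, a weakly separating functional has zero mean
   and hence vanishes almost everywhere on [D]; this eliminates one
   coordinate. *)
Lemma zero_mean_mixture (f : T -> I -> R) (D : set T) (J : {set I}) :
  measurable D -> (0 < mu D)%E ->
  (forall j, mu.-integrable D (fun s => (f s j)%:E)) ->
  (forall j, j \in J -> (\int[mu]_(s in D) (f s j)%:E = 0)%E) ->
  mixture D J f (fun=> 0).
Proof.
elim: {J}_.+1 {-2}J (ltnSn #|J|) D => // n IHn J Jn D mD muD intf f0.
have D0 : D !=set0.
  by apply/set0P; apply: contraTneq muD => ->; rewrite measure0 ltxx.
(* For empty [J] only the first alternative can occur, so the induction needs no separate base
   case. *)
have [//|[l [j0 j0J lj0] l_ge0]] := weak_separation J f D0.
pose g s := \sum_(j in J) l j * f s j.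
have gE s : (g s)%:E = (\sum_(j in J) ((l j)%:E * (f s j)%:E))%E.
  by rewrite -sumEFin; apply: eq_bigr => j _; rewrite EFinM.
have intlf j : mu.-integrable D (fun s => (l j)%:E * (f s j)%:E)%E.
  exact: integrableZl.
have intg : mu.-integrable D (fun s => (g s)%:E).
  under [X in integrable _ _ X]eq_fun do rewrite gE.
  exact: integrable_sum.
have g0 : ae_eq mu D (fun s => (g s)%:E) (cst 0%E).
  apply/ae_eq_integral_abs => //; first exact: measurable_int intg.
  transitivity (\int[mu]_(s in D) (g s)%:E)%E.
    by apply: eq_integral => s; rewrite inE => /l_ge0 gs; rewrite gee0_abs.
  under eq_integral do rewrite gE.
  rewrite integral_sum// big1// => j jJ.
  by rewrite integralZl// f0// mule0.
have [N [mN N0 subN]] := g0.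
have mDN : measurable (D `\` N) by exact: measurableD.
have [K [lam [s [lam_w sD lam0]]]] : mixture (D `\` N) (J :\ j0) f (fun=> 0).
  apply: IHn => //.
  - by move: Jn; rewrite (cardsD1 j0) j0J.
  - apply: (lt_le_trans muD); rewrite -[leRHS]adde0 -N0.
    apply: le_trans (measureU2 _ _ _) => //.
    apply: le_measure; rewrite ?inE//; first exact: measurableU.
    by move=> s Ds; have [Ns|] := pselect (N s); [right|left].
  - by move=> j; apply: integrableS (intf j) => //; exact: subDsetl.
  - move=> j; rewrite !inE => /andP[_ jJ].
    by rewrite -negligible_integral// f0.
exists K, lam, s; split=> // [k|j jJ]; first by have [] := sD k.
have [->|jj0] := eqVneq j j0; last by apply: lam0; rewrite !inE jj0.
(* Coordinate [j0] is recovered from [g], which vanishes at every sampled point: the other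
   coordinates average to 0 by induction, and [l j0] is nonzero. *)
apply/esym/eqP; rewrite -(mulrI_eq0 _ (lregP lj0)).
have <- : \sum_k lam k * g (s k) = l j0 * (\sum_k lam k * f (s k) j0).
  rewrite /g; under eq_bigr do rewrite mulr_sumr.
  rewrite exchange_big (bigD1 j0)//= [X in _ + X]big1 ?addr0 =>
      [|i /andP[iJ ij0]].
    by rewrite mulr_sumr; apply: eq_bigr => k _; rewrite mulrCA.
  under eq_bigr do rewrite mulrCA.
  by rewrite -mulr_sumr -lam0 ?mulr0// !inE ij0.
rewrite big1// => k _; have [Dk Nk] := sD k.
have [->|gk] := eqVneq (g (s k)) 0; first by rewrite mulr0.
by exfalso; apply/Nk/subN => /= /(_ Dk) [] /eqP; rewrite (negbTE gk).
Qed.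

(** Follows from the zero-mean case applied to [f - m]; finiteness of [mu D] makes the constant
    integrable. *)
Lemma mean_mixture (f : T -> I -> R) (D : set T) (m : I -> R) :
  measurable D -> (0 < mu D < +oo)%E ->
  (forall j, mu.-integrable D (fun s => (f s j)%:E)) ->
  (forall j, (\int[mu]_(s in D) (f s j)%:E = (m j)%:E * mu D)%E) ->
  mixture D [set: I] f m.
Proof.
move=> mD /andP[muD muDoo] intf fm.
have intm j : mu.-integrable D (cst (m j)%:E).
  by apply/integrableP; split; rewrite // integral_cst// lte_mul_pinfty.
have [||K [lam [s [lam_w sD lam0]]]] :=
    @zero_mean_mixture (fun s j => f s j - m j) D [set: I] mD muD.
- move=> j; under [X in integrable _ _ X]eq_fun do rewrite EFinB.
  exact: (integrableB mD (intf j) (intm j)).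
- move=> j _; under eq_integral do rewrite EFinB.
  rewrite (integralB mD (intf j) (intm j)) integral_cst// fm subee//.
  by rewrite fin_numM// ge0_fin_numE// ltW.
exists K, lam, s; split => // j jI; have /eqP := lam0 j jI.
under eq_bigr do rewrite mulrBr.
by rewrite sumrB -mulr_suml lam_w.2 mul1r eq_sym subr_eq0 => /eqP.
Qed.

End mean_of_measure.

(** * Convex hulls as sets of finite convex combinations *)

Section convex_hull.
Variables (R : realType) (I : finType).

Lemma convex_set_sum (C : set (I -> R)) (K : finType) (lam : K -> R)
    (x : K -> I -> R) :
  @convex_set R (I -> R^o) C -> weights lam -> (forall k, C (x k)) ->
  C (fun j => \sum_k lam k * x k j).
Proof.
move=> cC [lam0 lam1] xC.
have [k0 _|K0] := pickP {: K}; last first.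
  by move: lam1; rewrite big_pred0// => /esym/eqP; rewrite oner_eq0.
(* Partial sums need not have total weight 1, so each is written as its total weight times a point
   of [C]. When that total is 0, any point of [C] serves. *)
have step (r : seq K) : exists2 y, C y &
    forall j, \sum_(k <- r) lam k * x k j = (\sum_(k <- r) lam k) * y j.
  elim: r => [|k r [y Cy IHy]]; first exists (x k0) => // j.
    by rewrite !big_nil mul0r.
  set c := \sum_(k <- r) lam k in IHy.
  have c0 : 0 <= c by apply: sumr_ge0.
  have [ckE|ck0] := eqVneq (lam k + c) 0.
    exists y => // j; rewrite !big_cons IHy -/c ckE mul0r.
    move/eqP: ckE; rewrite paddr_eq0// => /andP[/eqP -> /eqP ->].
    by rewrite !mul0r addr0.
  have ck_gt0 : 0 < lam k + c by rewrite lt_neqAle eq_sym ck0 addr_ge0.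
  have t0 : 0 <= lam k / (lam k + c) by rewrite divr_ge0// ltW.
  have t1 : lam k / (lam k + c) <= 1 by rewrite ler_pdivrMr// mul1r lerDl.
  have := cC (x k) y (Itv01 t0 t1); rewrite !inE => /(_ (xC k) Cy) Cz.
  eexists; first exact: Cz.
  move=> j; rewrite !big_cons IHy -/c /conv/=.
  have -> : ((lam k / (lam k + c)) *: x k + (1 - lam k / (lam k + c)) *: y) j =
    lam k / (lam k + c) * x k j + (1 - lam k / (lam k + c)) * y j by [].
  by field.
have [y Cy sumE] := step (index_enum K).
rewrite (_ : (fun _ => _) = y)//; apply/funext => j.
by rewrite sumE lam1 mul1r.
Qed.

(** A convex set containing [X] contains all its mixtures; conversely the mixtures form a convex set
    containing [X], since two of them combine over the disjoint union of their index types. *)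
Lemma conv_hull_mixture (X : set (I -> R)) (m : I -> R) :
  @conv_hull R (I -> R^o) X m <-> mixture X [set: I] id m.
Proof.
split=> [|[K [lam [x [lam_w xX mE]]]]]; last first.
  have -> : m = (fun j => \sum_k lam k * x k j).
    by apply/funext => j; apply: mE; rewrite inE.
  by move=> C [cC XC]; apply: convex_set_sum => // k; exact: XC.
move: m; apply: smallest_sub.
  move=> m1 m2 t; rewrite !inE => -[K1 [lam1 [x1 [[lam10 lam11] xX1 m1E]]]]
    [K2 [lam2 [x2 [[lam20 lam21] xX2 m2E]]]].
  have t0 : 0 <= t%:num by [].
  have t1 : 0 <= 1 - t%:num by rewrite subr_ge0.
  exists (K1 + K2)%type.
  exists (fun k => match k with inl k => t%:num * lam1 k
                              | inr k => (1 - t%:num) * lam2 k end).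
  exists (fun k => match k with inl k => x1 k | inr k => x2 k end).
  split; last 1 first.
  - move=> j jI; rewrite big_sumType/= /conv/=.
    have -> : (t%:num *: m1 + (1 - t%:num) *: m2) j =
      t%:num * m1 j + (1 - t%:num) * m2 j by [].
    rewrite m1E// m2E// !mulr_sumr.
    by congr (_ + _); apply: eq_bigr => k _; rewrite mulrA.
  - split; first by case=> k; rewrite mulr_ge0.
    by rewrite big_sumType/= -!mulr_sumr lam11 lam21 !mulr1 subrKC.
  - by case.
move=> m Xm; exists unit, (fun=> 1), (fun=> m); split => //.
  by split=> //; rewrite big_const/= card_unit/= addr0.
by move=> j _; rewrite big_const/= card_unit/= addr0 mul1r.
Qed.

End convex_hull.

(** This is where the origin enters the hull: a mean posterior is scaled down by the probability of
    its action. *)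
Lemma conv_hull_shrink (R : realType) (I : finType) (X : set (I -> R))
    (m : I -> R) (t : R) :
  X 0 -> @conv_hull R (I -> R^o) X m -> 0 <= t <= 1 ->
  @conv_hull R (I -> R^o) X (fun j => t * m j).
Proof.
move=> X0 Xm /andP[t0 t1] C [cC XC].
have := cC m 0 (Itv01 t0 t1); rewrite !inE =>
  /(_ (Xm C (conj cC XC)) (XC _ X0)).
by rewrite /conv/= scaler0 addr0.
Qed.

(** * From a fully persuading scheme to the convex hulls *)

Section scheme_to_hull.
Context {R : realType} {Omega A : finType}.
Variables (w0 : Omega) (a0 : A) (mu0 : Omega -> R).
Variables (rho : (Omega -> R) -> A -> R) (v : Omega -> A -> R).
Hypothesis huniq : forall w, exists! a, forall a', v w a' <= v w a.
Variables (sch : signaling_scheme w0 mu0) (post : signal sch -> Omega -> R).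
Variable act : signal sch -> discrete_space a0.
Hypothesis post_sch : is_posterior post.
Hypothesis act_opt : optimal_strategy rho v post act.
Hypothesis act_full : {ae joint sch, forall p, sender_optimal v (act p.2) p.1}.

Let Sig (a : A) : set (signal sch) := act @^-1` [set (a : discrete_space a0)].

Let measurable_Sig a : measurable (Sig a).
Proof.
have [mact _ _] := act_opt.
by rewrite -[Sig a]setTI; apply: mact.
Qed.

(** Full persuasion makes a state and an action null together unless the action is sender-optimal
    there. If [a] is optimal at [w], uniqueness makes every other action null, so all of [mu0 w]
    falls on [Sig a]. *)
Let joint_tstar (a : A) (w : discrete_space w0) :
  joint sch ([set w] `*` Sig a) = (tstar mu0 v a w)%:E.
Proof.
have joint0 (B : set (signal sch)) : measurable B ->
    (forall s, B s -> ~ sender_optimal v (act s) w) ->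
    joint sch ([set w] `*` B) = 0%E.
  move=> mB Bw; apply: measure_negligible; first exact: measurableX.
  by apply: negligibleS act_full => -[w' s] /= [-> /Bw].
rewrite /tstar indicE; have [wa|wa] := boolP (w \in _); last first.
  rewrite mulr0; apply: joint0 => // s; rewrite /Sig/= => ->.
  by move/mem_set; apply/negP.
rewrite mulr1 -(joint_marginal sch).
have -> : [set w] `*` [set: signal sch] =
    [set w] `*` Sig a `|` [set w] `*` ~` Sig a.
  apply/seteqP; split=> [[w' s] /= [-> _]|[w' s] /= [[-> _]|[-> _]]] //.
  by have [sa|sa] := pselect (Sig a s); [left|right].
rewrite measureU//=.
- rewrite [X in (_ + X)%E]joint0 ?adde0//; first exact: measurableC.
  move=> s sa ws; apply: sa.
  have [b [_ buniq]] := huniq w.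
  by rewrite /Sig/=; rewrite -(buniq _ ws); apply: buniq; move: wa; rewrite inE.
- exact: measurableX.
- by apply: measurableX => //; exact: measurableC.
- by apply/seteqP; split=> // -[w' s] /= [[_ ?] [_]].
Qed.

Lemma tstar_conv_hull (a : A) :
  @conv_hull R (Omega -> R^o) (best_response rho a `|` [set 0]) (tstar mu0 v a).
Proof.
have [simplex_post mpost post_int] := post_sch.
have [_ act_br _] := act_opt.
pose D : set (discrete_space w0 * signal sch) := setT `*` Sig a.
have mD : measurable D by exact: measurableX.
pose p := fine (joint sch D).
have pE : joint sch D = p%:E by rewrite fineK// fin_num_measure.
have p0 : 0 <= p by rewrite fine_ge0.
have p1 : p <= 1 by rewrite -lee_fin -pE probability_le1.
(* An action taken with probability 0 has [tstar] equal to the origin; otherwise [tstar] is divided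
   by [p] to become a conditional mean of posteriors. *)
have [pD0|pD0] := eqVneq p 0.
  suff -> : tstar mu0 v a = 0 by apply: sub_gen_smallest; right.
  apply/funext => w; apply/EFin_inj; rewrite -(joint_tstar a w).
  apply: (subset_measure0 (B := D)) => //; first exact: measurableX.
    by move=> [w' s] [_ sa].
  by transitivity p%:E; [exact: pE|rewrite pD0].
have p_gt0 : 0 < p by rewrite lt_neqAle eq_sym pD0.
pose f (q : discrete_space w0 * signal sch) (w : Omega) := post q.2 w.
have -> : tstar mu0 v a = (fun w => p * (tstar mu0 v a w / p)).
  by apply/funext => w; rewrite mulrCA divff ?mulr1.
apply: conv_hull_shrink; [by right| |exact/andP].
apply/conv_hull_mixture.
have [|||K [lam [s [lam_w sD mE]]]] :=
  @mean_mixture _ _ _ _ (joint sch) f D (fun w => tstar mu0 v a w / p) mD.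
- by have : (0 < p%:E < +oo)%E; [rewrite lte_fin p_gt0 ltry|rewrite -pE].
- move=> w; apply: (@measurable_bounded_integrable _ _ _ _ (f ^~ w)) => //.
  + by rewrite -ge0_fin_numE// fin_num_measure.
  + apply: (measurable_funS measurableT) => //.
    exact: (measurableT_comp (mpost w) measurable_snd).
  + exists 1; split => // M M1 q _ /=.
    have [post0 post1] := simplex_post q.2.
    rewrite ger0_norm ?post0// (le_trans _ (ltW M1))// -post1 (bigD1 w)//=.
    by rewrite lerDl sumr_ge0.
- move=> w; transitivity ((tstar mu0 v a w / p)%:E * p%:E)%E;
    last by rewrite -pE.
  by rewrite -EFinM mulfVK// -(joint_tstar a w) post_int.
exists K, lam, (fun k => post (s k).2); split => // k; left.
by have [_ <-] := sD k; exact: act_br.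
Qed.

End scheme_to_hull.

(** * Finitely supported schemes *)

Section discrete_standard_borel.

(* The library's [discrete_topology T] is not inferred to be a [pointedType],
   hence not a [completeType], even when [T] is pointed. *)
Definition discrete_metric (T : pointedType) : Type := T.

HB.instance Definition _ (T : pointedType) := Pointed.on (discrete_metric T).
HB.instance Definition _ (T : pointedType) :=
  hasNbhs.Build (discrete_metric T) principal_filter.
HB.instance Definition _ (T : pointedType) :=
  Discrete_ofNbhs.Build (discrete_metric T) erefl.
HB.instance Definition _ (T : pointedType) :=
  DiscreteUniform_ofNbhs.Build (discrete_metric T).
HB.instance Definition _ (R : numDomainType) (T : pointedType) :=
  @DiscretePseudoMetric_ofUniform.Build R (discrete_metric T).

(** The diagonal is an entourage, so a Cauchy filter contains sets [A] and [B] with [A] times [B]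
    inside it; any point of [A] is then the only possible point of [B]. *)
Lemma discrete_cauchy_cvg (T : pointedType)
    (F : set_system (discrete_metric T)) :
  ProperFilter F -> cauchy F -> cvg F.
Proof.
move=> FF /(_ [set xy | xy.1 = xy.2]) [|[A B] [/= FA FB] AB].
  by rewrite uniform_discrete => _ [x _ <-].
have [a Aa] := filter_ex FA.
apply/cvg_ex; exists a; apply/discrete_cvg.
by apply: filterS FB => b Bb; exact: (esym (AB (a, b) (conj Aa Bb))).
Qed.

HB.instance Definition _ (T : pointedType) :=
  Uniform_isComplete.Build (discrete_metric T) (@discrete_cauchy_cvg T).

Lemma standard_borel_discrete (R : realType) (K : countType) (k0 : K) :
  standard_borel R (discrete_space k0).
Proof.
exists (discrete_metric (discrete_space k0)), id; split.
- exact: (@discrete_hausdorff (discrete_metric (discrete_space k0))).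
- exists setT; first exact: countableP.
  by move=> U [x Ux] _; exists x.
- by exists id.
- move=> B; split=> // _; apply: sub_sigma_algebra; exact: discrete_open.
Qed.

End discrete_standard_borel.

Section atomic_measure.
Local Open Scope ereal_scope.
Context d (T : measurableType d) (R : realType) (F : finType).
Variables (pt : F -> T) (c : F -> {nonneg R}).

(* [msum] takes a sequence of measures, whence the enumeration of [F]; the
   [None] case is never used. *)
Definition atomic : set T -> \bar R :=
  msum (fun n => if onth (enum F) n is Some i then mscale (c i) \d_(pt i)
                 else mzero) #|F|.

HB.instance Definition _ := Measure.on atomic.

Lemma sum_onth (g : option F -> \bar R) :
  \sum_(n < #|F|) g (onth (enum F) n) = \sum_i g (Some i).
Proof.
rewrite -[RHS]big_enum -(big_map Some xpredT g) (big_nth None).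
rewrite size_map -cardE big_mkord.
by apply: eq_bigr => n _; rewrite onthE.
Qed.

Lemma atomicE (D : set T) : atomic D = (\sum_i (c i)%:num * \1_D (pt i))%:E.
Proof.
rewrite /atomic/= /msum -sumEFin.
rewrite -(sum_onth (fun o => if o is Some i then
   ((c i)%:num * \1_D (pt i))%:E else 0)).
apply: eq_bigr => n _; case: onth => [i|] //=.
Qed.

Lemma integral_atomic (D : set T) (g : T -> R) :
  measurable D -> measurable_fun D g -> (forall t, 0 <= g t)%R ->
  \int[atomic]_(t in D) (g t)%:E =
  (\sum_i (c i)%:num * \1_D (pt i) * g (pt i))%:E.
Proof.
move=> mD mg g0.
have /measurable_EFinP mg' := mg.
rewrite /atomic ge0_integral_measure_sum//; last by move=> t _; rewrite lee_fin.
rewrite -sumEFin.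
transitivity (\sum_(n < #|F|) if onth (enum F) n is Some i then
   ((c i)%:num * \1_D (pt i) * g (pt i))%:E else 0).
  apply: eq_bigr => n _; case: onth => [i|];
    last by rewrite integral_measure_zero.
  rewrite ge0_integral_mscale//; last by move=> t _; rewrite lee_fin.
  by rewrite integral_dirac// diracE indicE -!EFinM mulrA.
exact: (sum_onth (fun o => if o is Some i then
   ((c i)%:num * \1_D (pt i) * g (pt i))%:E else 0)).
Qed.

End atomic_measure.

(** * From convex combinations to a fully persuading scheme *)

Section hull_to_scheme.
Context {R : realType} {Omega A : finType}.
Variables (w0 : Omega) (a0 : A) (mu0 : Omega -> R).
Variables (rho : (Omega -> R) -> A -> R) (v : Omega -> A -> R).
Variables (K : finType) (k0 : K) (lam : K -> R).
Variables (x : K -> Omega -> R) (b : K -> A).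
Hypothesis lam0 : forall k, 0 <= lam k.
Hypothesis x_br : forall k, best_response rho (b k) (x k).
Hypothesis x_supp : forall k w, x k w != 0 -> sender_optimal v (b k) w.
Hypothesis bary : forall w, \sum_k lam k * x k w = mu0 w.
Hypothesis mu0_simplex : simplex mu0.

Let x0 k w : 0 <= x k w. Proof. by have [[]] := x_br k. Qed.
Let x1 k : \sum_w x k w = 1. Proof. by have [[]] := x_br k. Qed.

Let point : Type := (discrete_space w0 * discrete_space k0)%type.

Let mass_ge0 (p : Omega * K) : 0 <= lam p.2 * x p.2 p.1.
Proof. by rewrite mulr_ge0. Qed.

(** The law of drawing signal [k] with probability [lam k] and then the state from [x k]. *)
Definition signal_joint : set point -> \bar R :=
  atomic (fun p : Omega * K => p : point) (fun p => NngNum (mass_ge0 p)).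

HB.instance Definition _ := Measure.on signal_joint.

Let signal_jointT : signal_joint setT = 1%E.
Proof.
rewrite /signal_joint atomicE; congr EFin; rewrite -mu0_simplex.2.
under eq_bigr do rewrite indicT mulr1/=.
rewrite -(pair_bigA_idem _ (fun w k => lam k * x k w))/=; first exact: eq_bigr.
by rewrite addr0.
Qed.

HB.instance Definition _ :=
  Measure_isProbability.Build _ _ _ signal_joint signal_jointT.

(** Any set is the union of its slices over the finitely many states, and each slice is a measurable
    rectangle. *)
Let measurable_point (N : set point) : measurable N.
Proof.
rewrite (_ : N = \bigcup_(w in [set: discrete_space w0])
    ([set w] `*` [set k | N (w, k)])).
  apply: fin_bigcup_measurable => [|w _]; first exact: (@finite_finset Omega).
  exact: measurableX.
apply/seteqP; split=> [[w k] Nwk|[w k] [w' _] [/= -> ]] //.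
by exists w.
Qed.

Let joint_rect (w : discrete_space w0) (B : set (discrete_space k0)) :
  signal_joint ([set w] `*` B) = (\sum_k lam k * x k w * \1_B k)%:E.
Proof.
rewrite /signal_joint atomicE; congr EFin.
transitivity (\sum_w' \sum_k lam k * x k w' * \1_([set w] `*` B) (w', k)).
  by rewrite pair_bigA.
rewrite (bigD1 w)//= [X in _ + X]big1 ?addr0 => [|w' ww'].
  apply: eq_bigr => k _; congr (_ * _); rewrite !indicE.
  congr (nat_of_bool _)%:R; by apply/idP/idP; rewrite !inE /=; [case|].
rewrite big1// => k _; rewrite indicE memNset ?mulr0//= => -[/eqP].
by rewrite (negbTE ww').
Qed.

Let joint_marg (w : discrete_space w0) :
  signal_joint ([set w] `*` [set: discrete_space k0]) = (mu0 w)%:E.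
Proof.
rewrite joint_rect -bary; congr EFin; apply: eq_bigr => k _.
by rewrite indicT mulr1.
Qed.

Let sch : signaling_scheme w0 mu0 :=
  SignalingScheme (standard_borel_discrete R k0) joint_marg.

Lemma fully_persuading_scheme : can_fully_persuade rho v w0 a0 mu0.
Proof.
exists sch, x, b; split.
- split=> [k|//|w B mB]; first by split.
  rewrite /= joint_rect /signal_joint integral_atomic//=.
    congr EFin.
    (* The variable [w'] is the realized state, on which the integrand does not depend; summing it
       out uses that each [x k] has total mass 1. *)
    transitivity (\sum_w' \sum_k lam k * x k w' * \1_B k * x k w).
      rewrite exchange_big/=; apply: eq_bigr => k _.
      under eq_bigr do rewrite -2!mulrA mulrCA.
      by rewrite -mulr_suml x1 mul1r mulrAC -mulrA.
    rewrite pair_bigA/=; apply: eq_bigr => p _; congr (_ * _ * _).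
    rewrite !indicE; congr (nat_of_bool _)%:R.
    by apply/idP/idP; rewrite !inE /=; [|case].
- split=> // k a' a'_br.
  (* Tie-breaking holds state by state: wherever [x k] puts mass, [b k] already maximizes [v]. *)
  rewrite -subr_ge0 -sumrB; apply: sumr_ge0 => w _.
  rewrite -mulrBr; have [->|xw] := eqVneq (x k w) 0; first by rewrite mul0r.
  by rewrite mulr_ge0// subr_ge0; exact: x_supp.
- exists (~` [set p | sender_optimal v (b p.2) p.1]); split => //.
  rewrite /= /signal_joint atomicE big1// => -[w k] _ /=.
  have [->|xw] := eqVneq (x k w) 0; first by rewrite mulr0 mul0r.
  rewrite indicE memNset ?mulr0//=; apply; exact: x_supp.
Qed.

End hull_to_scheme.

(** By uniqueness the sets [sender_optimal v a] partition the states, so exactly one term is nonzero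
    when [mu0 w] is. *)
Lemma sum_tstar (R : realType) (Omega A : finType) (mu0 : Omega -> R)
    (v : Omega -> A -> R) (w : Omega) :
  (exists! a, forall a', v w a' <= v w a) -> \sum_a tstar mu0 v a w = mu0 w.
Proof.
move=> [a [wa auniq]]; rewrite (bigD1 a)//= big1 => [|a' a'a].
  by rewrite addr0 /tstar indicE mem_set ?mulr1.
rewrite /tstar indicE memNset ?mulr0// => /auniq aa'.
by rewrite aa' eqxx in a'a.
Qed.

Lemma conv_hull_can_fully_persuade (R : realType) (Omega A : finType)
    (w0 : Omega) (a0 : A) (mu0 : Omega -> R) (rho : (Omega -> R) -> A -> R)
    (v : Omega -> A -> R) :
  simplex mu0 ->
  (forall w, exists! a, forall a', v w a' <= v w a) ->
  (forall a, @conv_hull R (Omega -> R^o) (best_response rho a `|` [set 0])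
     (tstar mu0 v a)) ->
  can_fully_persuade rho v w0 a0 mu0.
Proof.
move=> mu0_simplex huniq hull.
have /choice[f fP] a : exists g :
    {K : finType & ((K -> R) * (K -> Omega -> R))%type},
    [/\ weights (tagged g).1,
        forall k, (best_response rho a `|` [set 0]) ((tagged g).2 k) &
        forall w, tstar mu0 v a w = \sum_k (tagged g).1 k * (tagged g).2 k w].
  have /conv_hull_mixture[K [lam [x [lam_w xX mE]]]] := hull a.
  by exists (existT _ K (lam, x)); split=> // w; apply: mE; rewrite inE.
(* The combinations for all actions are pooled into one; the tag of an index is the action it
   recommends. *)
pose K : finType := {a : A & tag (f a)}.
pose lam (k : K) := (tagged (f (tag k))).1 (tagged k).
pose x (k : K) := (tagged (f (tag k))).2 (tagged k).
have lam0 k : 0 <= lam k by have [[+ _] _ _] := fP (tag k); exact.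
have xX k : (best_response rho (tag k) `|` [set 0]) (x k).
  by have [_ + _] := fP (tag k); exact.
have x0 k w : 0 <= x k w by have [[[+ _] _]|->] := xX k; first exact.
pose emb a (i : tag (f a)) : K := Tagged (fun a => tag (f a)) i.
have embE (k : K) : emb (tag k) (tagged k) = k by case: k.
have tE a w : tstar mu0 v a w = \sum_i lam (emb a i) * x (emb a i) w.
  by have [_ _] := fP a; exact.
have bary w : \sum_k lam k * x k w = mu0 w.
  rewrite -(sum_tstar mu0 (huniq w)); under [RHS]eq_bigr do rewrite tE.
  by rewrite sig_big_dep; apply: eq_bigr => k _; rewrite -[in RHS](embE k).
(* Good indices carry mass, which excludes zero weights and the point 0; one exists because [mu0]
   has total mass 1. *)
pose good k := [exists w, lam k * x k w != 0].
have [k0 good_k0] : exists k, good k.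
  apply: contrapT => no_good; have := mu0_simplex.2.
  rewrite big1 => [/esym/eqP|w _]; first by rewrite oner_eq0.
  rewrite -bary big1// => k _; apply/eqP/negP => /negP kw; apply: no_good.
  by exists k; apply/existsP; exists w.
have good_br k : good k -> best_response rho (tag k) (x k).
  move=> /existsP[w]; have [//|->] := xX k.
  by rewrite /= mulr0 eqxx.
have good_supp k w : good k -> x k w != 0 -> sender_optimal v (tag k) w.
  move=> /existsP[w' lamx] xw; apply: contrapT => wa.
  have lamk : lam k != 0 by apply: contra_neq lamx => ->; rewrite mul0r.
  (* Off the optimal states [tstar] is 0, so each nonnegative term of its decomposition vanishes. *)
  have /esym/eqP := tE (tag k) w.
  rewrite /tstar indicE memNset// mulr0 psumr_eq0 => [/allP|i _].
    move=> /(_ (tagged k) (mem_index_enum _)).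
    by rewrite embE mulf_eq0 (negbTE lamk) (negbTE xw).
  by rewrite mulr_ge0.
(* Bad indices get weight 0 and borrow the posterior and action of [k0], so every signal, even a
   null one, has a valid posterior and best response. *)
pose r k := if good k then k else k0.
have good_r k : good (r k) by rewrite /r; case: ifP.
apply: (@fully_persuading_scheme _ _ _ w0 a0 mu0 rho v K k0
  (fun k => if good k then lam k else 0) (fun k => x (r k)) (fun k => tag (r k))).
- by move=> k; case: ifP.
- by move=> k; exact: good_br.
- by move=> k w; exact: good_supp.
- move=> w; rewrite -bary; apply: eq_bigr => k _; rewrite /r.
  case: ifPn => // /existsPn/(_ w); rewrite negbK => /eqP ->.
  by rewrite mul0r.
- exact: mu0_simplex.
Qed.

Theorem theorem2 (R : realType) (Omega A : finType) (w0 : Omega) (a0 : A)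
    (mu0 : Omega -> R) (rho : (Omega -> R) -> A -> R) (v : Omega -> A -> R)
    (hmu0 : simplex mu0)
    (hclosed : forall a : A,
       closed (best_response rho a : set {ptws Omega -> R}))
    (huniq : forall w : Omega, exists! a : A, forall a' : A, v w a' <= v w a) :
  can_fully_persuade rho v w0 a0 mu0 <->
  forall a : A,
    @conv_hull R (Omega -> R^o) (best_response rho a `|` [set 0])
      (tstar mu0 v a).
Proof.
split; last exact: conv_hull_can_fully_persuade.
move=> [sch [post [act [hpost hact hfull]]]] a.
exact: (tstar_conv_hull huniq hpost hact hfull).
Qed.
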